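(* Let $\theta_1<\theta_2$ be real numbers, let $\alpha\in(0,1]$, and let $f:[\theta_1,\theta_2]\to\mathbb{R}$ be differentiable on $(\theta_1,\theta_2)$ with $f\in H^1(\theta_1,\theta_2)$ and $f'\in L_1[\theta_1,\theta_2]$. If $|f'|$ is concave on $(\theta_1,\theta_2)$, then $$\Bigg|\frac{2(\theta_2-\theta_1)^{\alpha}+(1-\alpha)2^{\alpha+1}\Gamma(\alpha)}{(\theta_2-\theta_1)^{\alpha+1}}\left[f(\theta_1)+f(\theta_2)+2f\left(\tfrac{\theta_1+\theta_2}{2}\right)\right]$$ $$-\frac{2^{\alpha+1}B(\alpha)\Gamma(\alpha)}{(\theta_2-\theta_1)^{\alpha+1}}\left[\left({}^{AB}I^{\alpha}_{\frac{\theta_1+\theta_2}{2}}f\right)(\theta_1)+\left({}^{AB}_{\theta_1}I^{\alpha}f\right)\left(\tfrac{\theta_1+\theta_2}{2}\right)+\left({}^{AB}_{\frac{\theta_1+\theta_2}{2}}I^{\alpha}f\right)(\theta_2)+\left({}^{AB}I^{\alpha}_{\theta_2}f\right)\left(\tfrac{\theta_1+\theta_2}{2}\right)\right]\Bigg|$$ $$\le\frac{1}{\alpha+1}\Bigg[\left|f'\left(\frac{\theta_1(\alpha+3)+\theta_2(\alpha+1)}{2(\alpha+2)}\right)\right|+\left|f'\left(\frac{\theta_1(2\alpha+3)+\theta_2}{2(\alpha+2)}\right)\right|$$ $$+\left|f'\left(\frac{\theta_2(2\alpha+3)+\theta_1}{2(\alpha+2)}\right)\right|+\left|f'\left(\f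rac{\theta_2(\alpha+3)+\theta_1(\alpha+1)}{2(\alpha+2)}\right)\right|\Bigg].$$
   Context: $\Gamma$ is the Gamma function and $B(\alpha)>0$ is the value at $\alpha$ of a normalization function $B$. $f\in H^1(\theta_1,\theta_2)$ means that $f$ is absolutely continuous on $[\theta_1,\theta_2]$ with $f'$ square integrable. The left and right Atangana-Baleanu fractional integrals of order $\alpha$ are, for $a<b$ in $[\theta_1,\theta_2]$, $$\left({}^{AB}_{a}I^{\alpha}f\right)(t)=\frac{1-\alpha}{B(\alpha)}f(t)+\frac{\alpha}{B(\alpha)\Gamma(\alpha)}\int_a^t f(y)(t-y)^{\alpha-1}\,dy\quad(t>a),$$ $$\left({}^{AB}I^{\alpha}_{b}f\right)(t)=\frac{1-\alpha}{B(\alpha)}f(t)+\frac{\alpha}{B(\alpha)\Gamma(\alpha)}\int_t^b f(y)(y-t)^{\alpha-1}\,dy\quad(t<b).$$ *)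

(* Defs.v *)
From mathcomp Require Import all_boot all_order all_algebra.
From mathcomp Require Import all_classical all_reals all_analysis.

Set Implicit Arguments.
Unset Strict Implicit.
Unset Printing Implicit Defensive.

Import Order.TTheory GRing.Theory Num.Theory.
Import numFieldNormedType.Exports.

Local Open Scope ring_scope.
Local Open Scope classical_set_scope.

Definition absolutely_continuous (R : realType) (a b : R) (f : R -> R) : Prop :=
  forall e : R, 0 < e -> exists2 d : R, 0 < d &
    forall (n : nat) (u v : 'I_n -> R),
      (forall i, [/\ a <= u i, u i <= v i & v i <= b]) ->
      trivIset setT (fun i => `]u i, v i[%classic) ->
      \sum_(i < n) (v i - u i) < d ->
      \sum_(i < n) `|f (v i) - f (u i)| < e.

(* [f] is total on [R], but membership only depends on its values on [a, b]:
   the derivative [f^`()] is restricted to the open interval (and extended by 0,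
   since [Lfun] is a predicate on functions on the whole line). *)
Definition in_H1 (R : realType) (a b : R) (f : R -> R) : Prop :=
  absolutely_continuous a b f /\
  (derive1 f \_ `]a, b[%classic)%R \in Lfun (@lebesgue_measure R) 2%:E.

(* Counterpart of the library's [convex_function]. *)
Definition concave_function (R : numFieldType) (E : lmodType R)
    (E' := convex_lmodType E) (D : set E') (f : E' -> R^o) : Prop :=
  forall t : {i01 R},
    {in D &, forall x y : E', conv t (f x) (f y) <= f (conv t x y)}.

Definition Gamma (R : realType) (s : R) : R :=
  \int[@lebesgue_measure R]_(x in `]0, +oo[) (x `^ (s - 1) * expR (- x)).

Definition AB_left (R : realType) (B : R -> R) (alpha a : R) (f : R -> R)
    (t : R) : R :=
  (1 - alpha) / B alpha * f t +
  alpha / (B alpha * Gamma alpha) *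
    \int[@lebesgue_measure R]_(y in `[a, t]) (f y * (t - y) `^ (alpha - 1)).

Definition AB_right (R : realType) (B : R -> R) (alpha b : R) (f : R -> R)
    (t : R) : R :=
  (1 - alpha) / B alpha * f t +
  alpha / (B alpha * Gamma alpha) *
    \int[@lebesgue_measure R]_(y in `[t, b]) (f y * (y - t) `^ (alpha - 1)).

(* Main.v *)
Require Import Defs.
From mathcomp Require Import all_boot all_order all_algebra.
From mathcomp Require Import all_classical all_reals all_analysis.
From mathcomp Require Import measurable_realfun ring lra.

Set Implicit Arguments.
Unset Strict Implicit.
Unset Printing Implicit Defensive.

Import Order.TTheory GRing.Theory Num.Theory.
Import numFieldNormedType.Exports.

Local Open Scope ring_scope.
Local Open Scope classical_set_scope.

(** Write m for the midpoint and h for the half length. By definition of the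
    Atangana-Baleanu integrals, the multiples of [f] that carry the factor
    (1 - alpha) / B(alpha) cancel against the second part of the first
    coefficient (this needs Gamma(alpha) to be nonzero), and what remains is
    h ^ (- alpha - 1) times a sum of four deviations
      h ^ alpha * f(e) - alpha * int_J f(y) u(y) ^ (alpha - 1) dy,
    where J is one of the two halves of the interval, e is an endpoint of J
    and u is the distance to the other endpoint ([AB_combination]).

    Integrating by parts, a deviation is, up to sign, the integral over J of
    f' u ^ alpha. As |f'| is concave, Jensen's inequality for the weight
    u ^ alpha, of total mass h ^ (alpha + 1) / (alpha + 1), bounds it by this
    mass times the value of |f'| at the barycentre c of the weight, which lies
    at distance (alpha + 1) / (alpha + 2) * h from the zero of u. The four
    barycentres are the four points of the statement.

    Neither step is carried out literally. Jensen's inequality is replaced by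
    its usual proof: a concave function lies below an affine function
    G + K (x - c) that agrees with it at c ([concave_supergradient]).
    Integration by parts is avoided by integrating this bound on |f'| first:
    the mean value theorem bounds |f(e) - f(y)| by a quadratic polynomial in
    u(y) ([ler_dist_of_affine_derive1]). Integrating this polynomial against
    u ^ (alpha - 1) only takes the moments of powers of u
    ([integral_powR_affine]), and the contribution of K vanishes by the choice
    of c ([powR_weighted_deviation]). *)

(** * Concave functions *)

(** This is concavity at c, seen as a convex combination of x and z, with the
    denominators cleared from the inequality between chord slopes. *)
Lemma concave_chord (R : realType) (a b x c z : R) (g : R -> R) :
  @concave_function R R^o `]a, b[%classic g ->
  a < x -> x < c -> c < z -> z < b ->
  (g z - g c) * (c - x) <= (g c - g x) * (z - c).
Proof.
move=> gconc ax xc cz zb.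
have xz : 0 < z - x by lra.
have t0 : 0 <= (z - c) / (z - x) by rewrite divr_ge0//; lra.
have t1 : (z - c) / (z - x) <= 1 by rewrite ler_pdivrMr//; lra.
pose t : {i01 R} := Itv01 t0 t1.
have xab : (x : R^o) \in (`]a, b[%classic : set R).
  by rewrite inE/= in_itv/=; apply/andP; split; lra.
have zab : (z : R^o) \in (`]a, b[%classic : set R).
  by rewrite inE/= in_itv/=; apply/andP; split; lra.
have : (z - c) / (z - x) * g x + (1 - (z - c) / (z - x)) * g z <=
    g ((z - c) / (z - x) * x + (1 - (z - c) / (z - x)) * z).
  exact: gconc t x z xab zab.
have -> : (z - c) / (z - x) * x + (1 - (z - c) / (z - x)) * z = c.
  by field; rewrite gt_eqF.
have -> : (z - c) / (z - x) * g x + (1 - (z - c) / (z - x)) * g z =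
  ((z - c) * g x + (c - x) * g z) / (z - x) by field; rewrite gt_eqF.
rewrite ler_pdivrMr//; nra.
Qed.

(** Every slope of a chord to the right of c is at most every slope of a chord
    to its left, so the supremum K of the former separates the two families.
    K is not a derivative of [g], which will be an absolute value and may have
    a corner at c. *)
Lemma concave_supergradient (R : realType) (a b c : R) (g : R -> R) :
  @concave_function R R^o `]a, b[%classic g -> a < c < b ->
  exists K, forall x, a < x < b -> g x <= g c + K * (x - c).
Proof.
move=> gconc /andP[ac cb].
pose S := [set (g z - g c) / (z - c) | z in `]c, b[%classic].
have S0 : S !=set0.
  exists ((g ((c + b) / 2) - g c) / ((c + b) / 2 - c)).
  by exists ((c + b) / 2) => //=; rewrite in_itv/=; apply/andP; split; lra.
have slope x : a < x < c -> ubound S ((g c - g x) / (c - x)).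
  move=> /andP[ax xc] _ [z /= + <-]; rewrite in_itv/= => /andP[cz zb].
  rewrite ler_pdivrMr ?subr_gt0// mulrAC ler_pdivlMr ?subr_gt0//.
  exact: (concave_chord gconc).
have Sub : has_ubound S.
  exists ((g c - g ((a + c) / 2)) / (c - (a + c) / 2)).
  by apply: slope; apply/andP; split; lra.
exists (sup S) => x /andP[ax xb]; rewrite -lerBlDl.
have [xc|cx|->] := ltgtP x c; last by rewrite !subrr mulr0.
- have : sup S <= (g c - g x) / (c - x).
    by apply: ge_sup => //; apply: slope; rewrite ax xc.
  rewrite ler_pdivlMr ?subr_gt0//; lra.
- rewrite -ler_pdivrMr ?subr_gt0//.
  by apply: ub_le_sup => //; exists x => //=; rewrite in_itv/= cx xb.
Qed.

(** * Increments controlled by the derivative *)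

(** Families made of a single interval already give uniform continuity. *)
Lemma absolutely_continuous_within (R : realType) (a b : R) (f : R -> R) :
  absolutely_continuous a b f -> {within `[a, b], continuous f}.
Proof.
move=> ac.
have small e : 0 < e -> exists2 d : R, 0 < d &
    forall u v, a <= u -> u <= v -> v <= b -> v - u < d -> `|f v - f u| < e.
  move=> /ac[d d0 H]; exists d => // u v au uv vb uvd.
  have := H 1%N (fun=> u) (fun=> v); rewrite !big_ord1; apply => //.
  by apply/trivIsetP => i j _ _; rewrite !ord1 eqxx.
apply/subspace_continuousP => x /=; rewrite in_itv/= => /andP[ax xb].
apply/cvgrPdist_lt => e /small[d d0 fd]; rewrite near_withinE.
exists d => //= y xyd; rewrite in_itv/= => /andP[ay yb].
have [xy|/ltW yx] := leP x y.
- by rewrite distrC fd// (le_lt_trans _ xyd)// distrC ler_norm.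
- by rewrite fd// (le_lt_trans _ xyd)// ler_norm.
Qed.

(** Both F - f and F + f are nondecreasing. *)
Lemma ler_dist_of_derive1 (R : realType) (a b : R) (f F : R -> R) :
  {within `[a, b], continuous f} -> {within `[a, b], continuous F} ->
  (forall x, x \in `]a, b[%R -> derivable f x 1) ->
  (forall x, x \in `]a, b[%R -> derivable F x 1) ->
  (forall x, x \in `]a, b[%R -> `|f^`() x| <= F^`() x) ->
  forall x y, a <= x -> x <= y -> y <= b -> `|f y - f x| <= F y - F x.
Proof.
move=> cf cF df dF ff x y ax xy yb.
have xab : x \in `[a, b]%R by rewrite in_itv/= ax (le_trans xy).
have yab : y \in `[a, b]%R by rewrite in_itv/= yb (le_trans ax).
have cD : {within `[a, b], continuous (F - f)}.
  by move=> z; apply: cvgB; [exact: cF|exact: cf].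
have cS : {within `[a, b], continuous (F + f)}.
  by move=> z; apply: cvgD; [exact: cF|exact: cf].
have D := @ger0_derive1_le_cc R (F - f) a b _ _ cD x y xab yab xy.
have S := @ger0_derive1_le_cc R (F + f) a b _ _ cS x y xab yab xy.
have {}D : F x - f x <= F y - f y.
  apply: D => z zab.
    by apply: derivableB; [exact: dF|exact: df].
  rewrite derive1E deriveB -?derive1E; [|exact: dF|exact: df].
  by rewrite subr_ge0 (le_trans (ler_norm _))// ff.
have {}S : F x + f x <= F y + f y.
  apply: S => z zab.
    by apply: derivableD; [exact: dF|exact: df].
  rewrite derive1E deriveD -?derive1E; [|exact: dF|exact: df].
  have := ler_norm (- f^`()%classic z); rewrite normrN.
  have := ff _ zab; lra.
rewrite ler_norml; apply/andP; split; lra.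
Qed.

(** The right-hand side is the increment of the primitive
    G z + K / 2 (z - c)^2 of the affine bound. *)
Lemma ler_dist_of_affine_derive1 (R : realType) (a b c G K : R) (f : R -> R) :
  {within `[a, b], continuous f} ->
  (forall x, x \in `]a, b[%R -> derivable f x 1) ->
  (forall x, x \in `]a, b[%R -> `|f^`() x| <= G + K * (x - c)) ->
  forall x y, a <= x -> x <= y -> y <= b ->
    `|f y - f x| <= G * (y - x) + K / 2 * ((y - c) ^+ 2 - (x - c) ^+ 2).
Proof.
move=> cf df f'_le x y ax xy yb.
pose F z := G * z + K / 2 * (z - c) ^+ 2.
have dF (z : R) : is_derive z 1 F (G + K * (z - c)).
  apply: is_derive_eq.
  by rewrite /GRing.scale/=; field.
have -> : G * (y - x) + K / 2 * ((y - c) ^+ 2 - (x - c) ^+ 2) = F y - F x.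
  by rewrite /F; ring.
apply: (@ler_dist_of_derive1 R a b f F) => //.
- apply: derivable_within_continuous => z _; exact: ex_derive.
- by move=> z /f'_le; rewrite [F^`()%classic z]derive1E; have [_ ->] := dF z.
Qed.

(** * Moments of powers of the distance to an endpoint *)

(** An improper fundamental theorem of calculus: [f] may blow up at the
    endpoints, as power kernels of negative exponent do. Monotone convergence
    along the segments that shrink the interval by d n at both ends reduces it
    to the case of a continuous function on a segment. *)
Lemma ge0_FTC2_oo (R : realType) (a b : R) (f F : R -> R) : a < b ->
  {in `]a, b[%R, continuous f} -> {in `]a, b[%R, forall x, 0 <= f x} ->
  derivable_oo_LRcontinuous F a b -> {in `]a, b[%R, F^`()%classic =1 f} ->
  (\int[@lebesgue_measure R]_(x in `]a, b[) (f x)%:E = (F b - F a)%:E)%E.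
Proof.
move=> ab cf f0 [dF Fa Fb] F'f.
(* The factor 1 / 3 keeps every E n nondegenerate. *)
pose d (n : nat) : R := (b - a) / 3 * n.+1%:R^-1.
have d0 n : 0 < d n by rewrite mulr_gt0 ?invr_gt0// divr_gt0 ?subr_gt0.
have dle n : d n <= (b - a) / 3.
  rewrite /d ler_piMr ?divr_ge0 ?subr_ge0 ?(ltW ab)//.
  by rewrite invf_le1 ?ler1n.
have dmono : {homo d : m n / (m <= n)%N >-> n <= m}.
  move=> m n mn; rewrite ler_pM2l ?divr_gt0 ?subr_gt0//.
  by rewrite lef_pV2 ?posrE// ler_nat.
have d_cvg : d n @[n --> \oo] --> 0.
  rewrite -(mulr0 ((b - a) / 3)); apply: cvgMr.
  exact: cvg_harmonic.
pose E n := `[a + d n, b - d n]%classic.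
have Esub n : E n `<=` `]a, b[%classic.
  move=> x; rewrite /E/= !in_itv/= => /andP[ax xb].
  by have dn := d0 n; apply/andP; split; lra.
have Eoo x n : x \in `]a + d n, b - d n[%R -> x \in `]a, b[%R.
  rewrite !in_itv/= => /andP[ax xb].
  by have dn := d0 n; apply/andP; split; lra.
have Eab n : a + d n < b - d n by have := dle n; lra.
have Ecup : \bigcup_n E n = `]a, b[%classic.
  apply/seteqP; split; first by move=> x [n _ /Esub].
  move=> x /=; rewrite in_itv/= => /andP[ax xb].
  have e0 : 0 < Num.min (x - a) (b - x) by rewrite lt_min !subr_gt0 ax xb.
  have /cvgrPdist_lt /(_ _ e0) [n _ /(_ n (leqnn n))] := d_cvg.
  rewrite /= sub0r normrN gtr0_norm// lt_min => /andP[dx dx'].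
  by exists n => //; rewrite /E/= in_itv/=; apply/andP; split; lra.
have cE n : {within E n, continuous f}.
  apply: continuous_in_subspaceT => x; rewrite inE => /Esub; exact: cf.
have FTC n : (\int[@lebesgue_measure R]_(x in E n) (f x)%:E =
    (F (b - d n) - F (a + d n))%:E)%E.
  rewrite EFinB; apply: continuous_FTC2 (Eab n) (cE n) _ _.
  - have cF x : x \in `]a, b[%R -> F y @[y --> x] --> F x.
      move=> xab; apply/differentiable_continuous/derivable1_diffP; exact: dF.
    split.
    + by move=> x /Eoo; exact: dF.
    + apply: cvg_at_right_filter; apply: cF; rewrite in_itv/=.
      by have := d0 n; have := dle n; move=> *; apply/andP; split; lra.
    + apply: cvg_at_left_filter; apply: cF; rewrite in_itv/=.
      by have := d0 n; have := dle n; move=> *; apply/andP; split; lra.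
  - by move=> x /Eoo; exact: F'f.
(* The integrals over E n converge to the integral over the open interval, but
   by the theorem on segments also to F b - F a. *)
have := @ge0_nondecreasing_set_cvg_integral _ (measurableTypeR R) R E
  (EFin \o f) (@lebesgue_measure R).
rewrite Ecup => C.
have {}C : (\int[@lebesgue_measure R]_(x in E n) (f x)%:E)%E @[n --> \oo] -->
   (\int[@lebesgue_measure R]_(x in `]a, b[) (f x)%:E)%E.
  apply: C => //.
  - move=> m n mn; rewrite subsetEset => x; rewrite /E/= !in_itv/=.
    by have := dmono _ _ mn => dmn /andP[ax xb]; apply/andP; split; lra.
  - move=> n; exact: measurable_itv.
  - move=> n; apply/measurable_EFinP; apply: subspace_continuous_measurable_fun.
      exact: measurable_itv.
    exact: cE.
  - by move=> n x /Esub xab; rewrite lee_fin; apply: f0.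
apply/esym/(cvg_unique _ _ C) => //=.
under eq_fun do rewrite FTC.
apply: cvg_EFin; first exact: nearW.
apply: cvgB.
- move: Fb => /cvg_at_leftP; apply; split.
    by move=> n; rewrite gtrBl.
  by rewrite -[X in _ --> X]subr0; apply: cvgB => //; exact: cvg_cst.
- move: Fa => /cvg_at_rightP; apply; split.
    by move=> n; rewrite ltrDl.
  by rewrite -[X in _ --> X]addr0; apply: cvgD => //; exact: cvg_cst.
Qed.

Lemma integrable_ge0_FTC2 (R : realType) (a b : R) (f F : R -> R) : a < b ->
  measurable_fun setT f -> (forall x, 0 <= f x) ->
  {in `]a, b[%R, continuous f} ->
  derivable_oo_LRcontinuous F a b -> {in `]a, b[%R, F^`()%classic =1 f} ->
  (@lebesgue_measure R).-integrable `[a, b] (EFin \o f) /\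
  \int[@lebesgue_measure R]_(x in `[a, b]) f x = F b - F a.
Proof.
move=> ab mf f0 cf dF F'f.
have int_f : (\int[@lebesgue_measure R]_(x in `[a, b]) (f x)%:E =
    (F b - F a)%:E)%E.
  rewrite integral_itv_bndoo; first by apply: ge0_FTC2_oo.
  by apply/measurable_EFinP; exact: measurable_funTS.
split; last by rewrite /Rintegral int_f.
apply/integrableP; split.
  by apply/measurable_EFinP; exact: measurable_funTS.
under eq_integral do rewrite /= ger0_norm//.
by rewrite int_f ltry.
Qed.

(** The slope k is 1 or -1 in the applications, for the distances y - a and
    b - y. The exponent s - 1 may be negative, so the integrand may be
    unbounded where the base vanishes. *)
Lemma integral_powR_affine (R : realType) (a b k l s : R) : a < b -> 0 < s ->
  k != 0 -> 0 <= k * a + l -> 0 <= k * b + l ->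
  (@lebesgue_measure R).-integrable `[a, b]
    (EFin \o (fun y => (k * y + l) `^ (s - 1))) /\
  \int[@lebesgue_measure R]_(y in `[a, b]) (k * y + l) `^ (s - 1) =
    ((k * b + l) `^ s - (k * a + l) `^ s) / (k * s).
Proof.
move=> ab s0 k0 ua0 ub0.
have ks0 : k * s != 0 by rewrite mulf_neq0 ?(gt_eqF s0).
pose u y := k * y + l.
have cu : continuous u.
  by move=> x; apply: cvgD; [exact: mulrl_continuous|exact: cvg_cst].
have dpow x : 0 < u x ->
    is_derive x 1 (fun y => u y `^ s) (s * u x `^ (s - 1) * k).
  move=> ux; apply: (@is_derive1_comp R (fun v => v `^ s) u).
    exact: is_derive1_powR.
  rewrite -[X in is_derive _ _ _ X]addr0; apply: is_deriveD.
  rewrite -[X in is_derive _ _ _ X]mulr1; exact: is_deriveZ.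
have cpow r x : 0 < u x -> u y `^ r @[y --> x] --> u x `^ r.
  move=> ux.
  apply: (@continuous_comp _ _ _ u (fun v => v `^ r)); first exact: cu.
  have [+ _] := is_derive1_powR r ux.
  by move=> /derivable1_diffP/differentiable_continuous.
have u_gt0 x : a < x < b -> 0 < u x.
  move=> /andP[ax xb]; rewrite /u; move: k0; rewrite neq_lt => /orP[k0|k0]; nra.
(* An endpoint where the base vanishes is approached from the side on which
   the base is positive; there the power is only one-sided continuous. *)
have pow0 x (v : nat -> R) : u x = 0 -> (forall n, 0 < u (v n)) ->
    v n @[n --> \oo] --> x -> u (v n) `^ s @[n --> \oo] --> u x `^ s.
  move=> ux0 uv0 cv; rewrite ux0 powR0 ?gt_eqF//.
  have /cvg_at_rightP := powR_cvg0 s0; apply; split => //.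
  by rewrite -ux0; apply: continuous_cvg => //; exact: cu.
have -> : ((k * b + l) `^ s - (k * a + l) `^ s) / (k * s) =
    u b `^ s / (k * s) - u a `^ s / (k * s) by rewrite mulrBl.
apply: (@integrable_ge0_FTC2 R a b _ (fun y => u y `^ s / (k * s))) => //.
- apply: (measurableT_comp (measurable_powR _)).
  exact: continuous_measurable_fun.
- by move=> x; exact: powR_ge0.
- by move=> x; rewrite in_itv/= => /u_gt0; exact: cpow.
- split.
  + move=> x; rewrite in_itv/= => /u_gt0/dpow[dx _].
    by apply: derivableM; [exact: dx|exact: derivable_cst].
  + apply: cvgMl; have [ua|ua] := ltP 0 (u a).
      by apply: cvg_at_right_filter; exact: cpow.
    have {}ua : u a = 0 by apply/eqP; rewrite eq_le ua.
    apply/cvg_at_rightP => v [av va]; apply: pow0 => // n.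
    rewrite /u in ua ua0 ub0 *; have := av n.
    move: k0; rewrite neq_lt => /orP[k0|k0]; nra.
  + apply: cvgMl; have [ub|ub] := ltP 0 (u b).
      by apply: cvg_at_left_filter; exact: cpow.
    have {}ub : u b = 0 by apply/eqP; rewrite eq_le ub.
    apply/cvg_at_leftP => v [vb bv]; apply: pow0 => // n.
    rewrite /u in ub ua0 ub0 *; have := vb n.
    move: k0; rewrite neq_lt => /orP[k0|k0]; nra.
- move=> x; rewrite in_itv/= => /u_gt0/dpow[dx dxE].
  rewrite derive1E deriveM; [|exact: dx|exact: derivable_cst].
  rewrite dxE derive_cst scaler0 add0r /GRing.scale/= /u.
  by move: ks0; rewrite mulf_eq0 negb_or => /andP[? ?]; field; apply/andP.
Qed.

(** * Positivity of the Gamma function *)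

(** The integral has to be shown finite, since the real-valued integral of a
    function with infinite integral is 0. The integrand is below
    x ^ (s - 1) on (0, 1] and, as s <= 1, below exp (- x) beyond 1; it is at
    least exp (- 1) on (0, 1], whence positivity. *)
Lemma Gamma_gt0 (R : realType) (s : R) : 0 < s <= 1 -> 0 < Gamma s.
Proof.
move=> /andP[s0 s1].
have sB1_le0 : s - 1 <= 0 by rewrite subr_le0.
pose mu := @lebesgue_measure R.
pose g (x : R) := x `^ (s - 1) * expR (- x).
have g0 x : 0 <= g x by rewrite mulr_ge0 ?powR_ge0 ?expR_ge0.
have mg : measurable_fun setT g.
  apply: measurable_funM; first exact: measurable_powR.
  by apply: measurableT_comp; [exact: measurable_expR|exact: measurable_funN].
have mgE D : measurable_fun D (EFin \o g).
  by apply/measurable_EFinP; exact: measurable_funTS.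
pose p := (fun x : R => x `^ (s - 1)) \_ `[0, 1].
have p0 x : 0 <= p x by apply: restrict_ge0 => y _; exact: powR_ge0.
have ip : mu.-integrable setT (EFin \o p).
  rewrite -restrict_EFin; apply/integrable_restrict => //; rewrite setTI.
  have [//|||+ _] := @integral_powR_affine R 0 1 1 0 s _ s0 (oner_neq0 _).
  - by rewrite mulr0 addr0.
  - by rewrite mulr1 addr0.
  have -> // : (fun y : R => (1 * y + 0) `^ (s - 1)) = (fun y => y `^ (s - 1)).
  by apply/funext => y; rewrite mul1r addr0.
have ig : mu.-integrable `]0, +oo[ (EFin \o g).
  apply: (@le_integrable _ _ _ mu _ _ _
    ((EFin \o p) \+ (EFin \o exponential_pdf 1))%E) => //; first exact: mgE.
  - move=> x; rewrite /= in_itv/= andbT => x0.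
    rewrite ger0_norm//= ger0_norm; last first.
      by rewrite addr_ge0// exponential_pdf_ge0.
    rewrite lee_fin exponential_pdfE ?(ltW x0)// mul1r mulN1r.
    have [x1|x1] := leP x 1.
    + rewrite /p patchE ifT; last by rewrite inE/= in_itv/= x1 andbT ltW.
      rewrite ler_wpDr ?expR_ge0// /g ler_piMr ?powR_ge0//.
      by rewrite -expR0 ler_expR oppr_le0 ltW.
    + rewrite ler_wpDl//.
      rewrite /g ler_piMl ?expR_ge0//.
      by have := ler_powR (ltW x1) sB1_le0; rewrite powRr0.
  - apply: (@integrableD _ _ _ mu) => //.
    + by apply: integrableS ip.
    + by apply: integrableS (integrable_exponential_pdf ltr01).
rewrite /Gamma -/mu.
apply: fine_gt0; apply/andP; split; last first.
  rewrite -ge0_fin_numE.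
    exact: integrable_fin_num ig.
  by apply: integral_ge0 => x _; rewrite lee_fin; exact: g0.
have e_gt0 : (0 < \int[mu]_(x in `]0%R, 1%R]) (expR (-1))%:E)%E.
  rewrite integral_cst//= lebesgue_measure_itv/= lte_fin ltr01 sube0.
  by rewrite mule1 lte_fin expR_gt0.
have e_le : (\int[mu]_(x in `]0%R, 1%R]) (expR (-1))%:E <=
    \int[mu]_(x in `]0%R, 1%R]) (g x)%:E)%E.
  apply: ge0_le_integral => //.
  - exact: mgE.
  - move=> x; rewrite /= in_itv/= => /andP[x0 x1]; rewrite lee_fin /g.
    rewrite -[leLHS]mul1r ler_pM ?expR_ge0//; last by rewrite ler_expR lerN2.
    have x01 : 0 < x <= 1 by rewrite x0.
    by have := ger_powR x01 sB1_le0; rewrite powRr0.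
apply: lt_le_trans e_gt0 (le_trans e_le _).
apply: ge0_subset_integral => //.
- exact: mgE.
- by move=> x _; rewrite lee_fin g0.
- exact: subset_itvl.
Qed.

(** * Deviation of a function from its power-weighted integral *)

Lemma powRS (R : realType) (x r : R) : 0 < x -> x `^ (r + 1) = x `^ r * x.
Proof. by move=> x0; rewrite powRD ?powRr1 ?ltW// (gt_eqF x0) implybT. Qed.

Lemma integrable_continuousM (R : realType) (a b : R) (f w : R -> R) :
  {within `[a, b], continuous f} ->
  (@lebesgue_measure R).-integrable `[a, b] (EFin \o w) ->
  (@lebesgue_measure R).-integrable `[a, b] (EFin \o (fun y => f y * w y)).
Proof.
move=> cf iw.
apply: (@integrableMr _ _ _ (@lebesgue_measure R) _ _ f (EFin \o w)) => //.
  by apply: subspace_continuous_measurable_fun.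
have [M [Mreal fM]] :=
  compact_bounded (continuous_compact cf (@segment_compact _ _ _)).
by exists M; split => // N MN y yab; apply: (fM N MN); exists y.
Qed.

(** The last hypothesis is the bound obtained by integrating
    |f'| <= G + K (x - c) between y and the endpoint where [u] equals h, both
    points being located by [u]; [v] stands for the value of [f] at that endpoint. Stating the result
    in terms of [u] treats both orientations of the interval at once. *)
Lemma powR_weighted_deviation (R : realType) (a b alpha v G K : R)
    (f u : R -> R) (h := b - a) (c := (alpha + 1) / (alpha + 2) * h) :
  a < b -> 0 < alpha ->
  {within `[a, b], continuous f} ->
  (forall y, a <= y <= b -> 0 <= u y) ->
  (forall s, 0 < s ->
    (@lebesgue_measure R).-integrable `[a, b]
      (EFin \o (fun y => u y `^ (s - 1))) /\
    \int[@lebesgue_measure R]_(y in `[a, b]) u y `^ (s - 1) = h `^ s / s) ->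
  (forall y, a <= y <= b ->
    `|v - f y| <= G * (h - u y) + K / 2 * ((h - c) ^+ 2 - (u y - c) ^+ 2)) ->
  `|h `^ alpha * v -
    alpha * \int[@lebesgue_measure R]_(y in `[a, b]) (f y * u y `^ (alpha - 1))|
  <= h `^ (alpha + 1) / (alpha + 1) * G.
Proof.
move=> ab al0 cf u0 mom fq.
have h0 : 0 < h by rewrite subr_gt0.
have [al1 al2] : 0 < alpha + 1 /\ 0 < alpha + 2 by split; lra.
pose mu := @lebesgue_measure R.
(* The n-th moment of u for the weight u ^ (alpha - 1) is the integral of w n;
   A, B and C are the coefficients of the quadratic bound in powers of u. *)
pose w n y := u y `^ (alpha + n%:R - 1).
pose A := G * h + K / 2 * ((h - c) ^+ 2 - c ^+ 2).
pose B := - G + K * c.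
pose C := - (K / 2).
have {}mom n : mu.-integrable `[a, b] (EFin \o w n) /\
    \int[mu]_(y in `[a, b]) w n y = h `^ (alpha + n%:R) / (alpha + n%:R).
  by apply: mom; rewrite ltr_wpDr.
have wS n y : a <= y <= b -> w n.+1 y = u y * w n y.
  move=> yab; rewrite /w mulr_powRB1 ?u0//; last by rewrite ltr_wpDr.
  by congr (_ `^ _); rewrite -natr1; ring.
have iZ k n : mu.-integrable `[a, b] (EFin \o (fun y => k * w n y)).
  exact: integrableZl (mom n).1.
have ifw : mu.-integrable `[a, b] (EFin \o (fun y => f y * w 0%N y)).
  exact: integrable_continuousM cf (mom 0%N).1.
have idev : mu.-integrable `[a, b]
    (EFin \o (fun y => v * w 0%N y - f y * w 0%N y)).
  exact: integrableB (iZ _ _) ifw.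
have iAB : mu.-integrable `[a, b]
    (EFin \o (fun y => A * w 0%N y + B * w 1%N y)).
  exact: integrableD (iZ _ _) (iZ _ _).
have iQ : mu.-integrable `[a, b]
    (EFin \o (fun y => A * w 0%N y + B * w 1%N y + C * w 2%N y)).
  exact: integrableD iAB (iZ _ _).
have -> : h `^ alpha * v - alpha *
      \int[mu]_(y in `[a, b]) (f y * u y `^ (alpha - 1)) =
    alpha * \int[mu]_(y in `[a, b]) (v * w 0%N y - f y * w 0%N y).
  rewrite RintegralB// RintegralZl//; last exact: (mom _).1.
  rewrite (mom 0%N).2 /w addr0; field; exact: lt0r_neq0.
rewrite normrM (gtr0_norm al0).
apply: (@le_trans _ _ (alpha *
    \int[mu]_(y in `[a, b]) (A * w 0%N y + B * w 1%N y + C * w 2%N y))).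
  rewrite ler_pM2l//.
  apply: (le_trans (le_normr_Rintegral _ idev)) => //.
  apply: le_Rintegral => //; first exact: (integrable_norm idev).
  move=> y; rewrite /= in_itv/= => yab.
  rewrite !wS// -mulrBl normrM (ger0_norm (powR_ge0 _ _)).
  have -> : A * w 0%N y + B * (u y * w 0%N y) + C * (u y * (u y * w 0%N y)) =
    (G * (h - u y) + K / 2 * ((h - c) ^+ 2 - (u y - c) ^+ 2)) * w 0%N y.
    by rewrite /A /B /C; field.
  by rewrite ler_wpM2r ?powR_ge0// fq.
rewrite RintegralD// RintegralD// !RintegralZl//; try exact: (mom _).1.
rewrite !(mom _).2 addr0.
have -> : alpha + 2 = alpha + 1 + 1 by ring.
(* Both sides are equal: c is chosen so that the coefficient of K is 0. *)
rewrite !powRS// le_eqVlt; apply/orP; left; apply/eqP.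
rewrite /A /B /C /c; field.
by rewrite !lt0r_neq0//; lra.
Qed.

Lemma left_kernel_deviation (R : realType) (a b alpha G K : R) (f : R -> R)
    (c := a + (alpha + 1) / (alpha + 2) * (b - a)) :
  a < b -> 0 < alpha ->
  {within `[a, b], continuous f} ->
  (forall x, x \in `]a, b[%R -> derivable f x 1) ->
  (forall x, x \in `]a, b[%R -> `|f^`() x| <= G + K * (x - c)) ->
  `|(b - a) `^ alpha * f b - alpha *
    \int[@lebesgue_measure R]_(y in `[a, b]) (f y * (y - a) `^ (alpha - 1))|
  <= (b - a) `^ (alpha + 1) / (alpha + 1) * G.
Proof.
move=> ab al0 cf df f'_le.
apply: (@powR_weighted_deviation R a b alpha (f b) G K f
  (fun y => y - a)) => //.
- by move=> y /andP[ay _]; rewrite subr_ge0.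
- move=> s s0.
  have [||+ +] := @integral_powR_affine R a b 1 (- a) s ab s0 (oner_neq0 _).
  + by rewrite mul1r subrr.
  + by rewrite mul1r subr_ge0 ltW.
  have -> : (fun y : R => (1 * y - a) `^ (s - 1)) =
            (fun y => (y - a) `^ (s - 1)).
    by apply/funext => y; rewrite mul1r.
  by rewrite !mul1r subrr powR0 ?gt_eqF// subr0.
- move=> y /andP[ay yb].
  apply: le_trans (ler_dist_of_affine_derive1 cf df f'_le ay yb (lexx b)) _.
  by rewrite le_eqVlt; apply/orP; left; apply/eqP; rewrite /c; ring.
Qed.

Lemma right_kernel_deviation (R : realType) (a b alpha G K : R) (f : R -> R)
    (c := b - (alpha + 1) / (alpha + 2) * (b - a)) :
  a < b -> 0 < alpha ->
  {within `[a, b], continuous f} ->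
  (forall x, x \in `]a, b[%R -> derivable f x 1) ->
  (forall x, x \in `]a, b[%R -> `|f^`() x| <= G + K * (x - c)) ->
  `|(b - a) `^ alpha * f a - alpha *
    \int[@lebesgue_measure R]_(y in `[a, b]) (f y * (b - y) `^ (alpha - 1))|
  <= (b - a) `^ (alpha + 1) / (alpha + 1) * G.
Proof.
move=> ab al0 cf df f'_le.
(* Distances to b reverse the orientation, hence the sign of K. *)
apply: (@powR_weighted_deviation R a b alpha (f a) G (- K) f
  (fun y => b - y)) => //.
- by move=> y /andP[_ yb]; rewrite subr_ge0.
- move=> s s0.
  have [|||+ +] := @integral_powR_affine R a b (-1) b s ab s0.
  + by rewrite oppr_eq0 oner_neq0.
  + by rewrite mulN1r addrC subr_ge0 ltW.
  + by rewrite mulN1r addrC subrr.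
  have -> : (fun y : R => (-1 * y + b) `^ (s - 1)) =
            (fun y => (b - y) `^ (s - 1)).
    by apply/funext => y; rewrite mulN1r addrC.
  by rewrite !mulN1r addNr powR0 ?gt_eqF// sub0r invrN mulrNN [- a + b]addrC.
- move=> y /andP[ay yb]; rewrite distrC.
  apply: le_trans (ler_dist_of_affine_derive1 cf df f'_le (lexx a) ay yb) _.
  by rewrite le_eqVlt; apply/orP; left; apply/eqP; rewrite /c; ring.
Qed.

(** * The trapezoidal inequality *)

(** The powers are abstracted as P = h ^ alpha and T = 2 ^ alpha, [b] and [G]
    stand for B(alpha) and Gamma(alpha), and I1 to I4 for the four kernel
    integrals. *)
Lemma AB_combination (R : fieldType) (P T h al b G f1 f2 fm I1 I2 I3 I4 : R) :
  P != 0 -> T != 0 -> h != 0 -> b != 0 -> G != 0 -> 2 != 0 :> R ->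
  (2 * (T * P) + (1 - al) * (T * 2) * G) / (T * P * (2 * h))
    * (f1 + f2 + 2 * fm)
  - T * 2 * b * G / (T * P * (2 * h))
    * ((1 - al) / b * f1 + al / (b * G) * I1
       + ((1 - al) / b * fm + al / (b * G) * I2)
       + ((1 - al) / b * f2 + al / (b * G) * I4)
       + ((1 - al) / b * fm + al / (b * G) * I3))
  = ((P * fm - al * I1) + (P * f1 - al * I2) + (P * f2 - al * I3)
     + (P * fm - al * I4)) / (P * h).
Proof.
by move=> P0 T0 h0 b0 G0 two0; field; rewrite P0 T0 h0 b0 G0 two0.
Qed.

Theorem theorem2p5 (R : realType) (theta1 theta2 alpha : R) (B f : R -> R)
    (m := (theta1 + theta2) / 2)
    (htheta : theta1 < theta2)
    (halpha : 0 < alpha <= 1)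
    (hB : 0 < B alpha)
    (hdiff : forall x : R, theta1 < x < theta2 -> derivable f x 1)
    (hH1 : in_H1 theta1 theta2 f)
    (hL1 : (@lebesgue_measure R).-integrable `[theta1, theta2]
             (EFin \o f^`()))
    (hconc : @concave_function R R^o `]theta1, theta2[%classic
               (fun x => `|f^`() x|)) :
  `| (2 * (theta2 - theta1) `^ alpha
        + (1 - alpha) * 2 `^ (alpha + 1) * Gamma alpha)
       / (theta2 - theta1) `^ (alpha + 1)
       * (f theta1 + f theta2 + 2 * f m)
     - 2 `^ (alpha + 1) * B alpha * Gamma alpha
       / (theta2 - theta1) `^ (alpha + 1)
       * (AB_right B alpha m f theta1 + AB_left B alpha theta1 f m
          + AB_left B alpha m f theta2 + AB_right B alpha theta2 f m) |
  <= 1 / (alpha + 1)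
     * (`|f^`() ((theta1 * (alpha + 3) + theta2 * (alpha + 1))
                 / (2 * (alpha + 2)))|
        + `|f^`() ((theta1 * (2 * alpha + 3) + theta2) / (2 * (alpha + 2)))|
        + `|f^`() ((theta2 * (2 * alpha + 3) + theta1) / (2 * (alpha + 2)))|
        + `|f^`() ((theta2 * (alpha + 3) + theta1 * (alpha + 1))
                   / (2 * (alpha + 2)))|).
Proof.
have /andP[al0 _] := halpha.
have Gam0 := Gamma_gt0 halpha.
have cf := absolutely_continuous_within hH1.1.
have [t1m mt2] : theta1 < m /\ m < theta2 by rewrite /m; split; lra.
have hE1 : m - theta1 = (theta2 - theta1) / 2 by rewrite /m; field.
have hE2 : theta2 - m = (theta2 - theta1) / 2 by rewrite /m; field.
set h := (theta2 - theta1) / 2 in hE1 hE2.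
have h0 : 0 < h by rewrite divr_gt0 ?subr_gt0.
have [al1 al2] : 0 < alpha + 1 /\ 0 < alpha + 2 by split; lra.
pose lam := (alpha + 1) / (alpha + 2).
have [lam0 lam1] : 0 < lam /\ lam < 1.
  by rewrite /lam divr_gt0// ltr_pdivrMr// mul1r; split=> //; lra.
have [cf1 cf2] : {within `[theta1, m], continuous f} /\
    {within `[m, theta2], continuous f}.
  split; apply: continuous_subspaceW cf.
    by apply: subset_itvl; rewrite bnd_simp ltW.
  by apply: subset_itvr; rewrite bnd_simp ltW.
have inl x : x \in `]theta1, m[%R -> theta1 < x < theta2.
  by rewrite in_itv/= => /andP[? ?]; apply/andP; split; lra.
have inr x : x \in `]m, theta2[%R -> theta1 < x < theta2.
  by rewrite in_itv/= => /andP[? ?]; apply/andP; split; lra.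
(* The barycentres of the four weights; those of the weights vanishing at the
   left end of a half interval are c1 and c3. *)
pose c1 := theta1 + lam * (m - theta1).
pose c2 := m - lam * (m - theta1).
pose c3 := m + lam * (theta2 - m).
pose c4 := theta2 - lam * (theta2 - m).
have -> : (theta1 * (alpha + 3) + theta2 * (alpha + 1)) / (2 * (alpha + 2)) =
    c1.
  by rewrite /c1 /lam /m; field; exact: lt0r_neq0.
have -> : (theta1 * (2 * alpha + 3) + theta2) / (2 * (alpha + 2)) = c2.
  by rewrite /c2 /lam /m; field; exact: lt0r_neq0.
have -> : (theta2 * (2 * alpha + 3) + theta1) / (2 * (alpha + 2)) = c3.
  by rewrite /c3 /lam /m; field; exact: lt0r_neq0.
have -> : (theta2 * (alpha + 3) + theta1 * (alpha + 1)) / (2 * (alpha + 2)) =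
    c4.
  by rewrite /c4 /lam /m; field; exact: lt0r_neq0.
have [lamh_gt0 lamh_lt] : 0 < lam * h /\ lam * h < h.
  by rewrite mulr_gt0// gtr_pMl.
have c1I : theta1 < c1 < theta2.
  by rewrite /c1 hE1; apply/andP; split; lra.
have c2I : theta1 < c2 < theta2.
  by rewrite /c2 hE1; apply/andP; split; lra.
have c3I : theta1 < c3 < theta2.
  by rewrite /c3 hE2; apply/andP; split; lra.
have c4I : theta1 < c4 < theta2.
  by rewrite /c4 hE2; apply/andP; split; lra.
have [K1 sup1] := concave_supergradient hconc c1I.
have [K2 sup2] := concave_supergradient hconc c2I.
have [K3 sup3] := concave_supergradient hconc c3I.
have [K4 sup4] := concave_supergradient hconc c4I.
have := left_kernel_deviation t1m al0 cf1 (fun x xI => hdiff x (inl x xI))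
  (fun x xI => sup1 x (inl x xI)).
have := right_kernel_deviation t1m al0 cf1 (fun x xI => hdiff x (inl x xI))
  (fun x xI => sup2 x (inl x xI)).
have := left_kernel_deviation mt2 al0 cf2 (fun x xI => hdiff x (inr x xI))
  (fun x xI => sup3 x (inr x xI)).
have := right_kernel_deviation mt2 al0 cf2 (fun x xI => hdiff x (inr x xI))
  (fun x xI => sup4 x (inr x xI)).
rewrite /AB_left /AB_right hE1 hE2.
set I4 := \int[@lebesgue_measure R]_(y in `[m, theta2])
  (f y * (theta2 - y) `^ (alpha - 1)).
set I3 := \int[@lebesgue_measure R]_(y in `[m, theta2])
  (f y * (y - m) `^ (alpha - 1)).
set I2 := \int[@lebesgue_measure R]_(y in `[theta1, m])
  (f y * (m - y) `^ (alpha - 1)).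
set I1 := \int[@lebesgue_measure R]_(y in `[theta1, m])
  (f y * (y - theta1) `^ (alpha - 1)).
have t12E : theta2 - theta1 = 2 * h by rewrite /h; field.
move=> D4 D3 D2 D1.
have TE : 2 `^ (alpha + 1) = 2 `^ alpha * 2 by exact: powRS.
have PE : h `^ (alpha + 1) = h `^ alpha * h by exact: powRS.
have LE : (2 * h) `^ alpha = 2 `^ alpha * h `^ alpha.
  by rewrite powRM ?(ltW h0).
have L1E : (2 * h) `^ (alpha + 1) = 2 `^ alpha * h `^ alpha * (2 * h).
  by rewrite powRS ?LE// mulr_gt0.
rewrite t12E TE L1E LE AB_combination ?lt0r_neq0 ?powR_gt0//.
have Ph0 : 0 < h `^ alpha * h by rewrite mulr_gt0 ?powR_gt0.
rewrite normrM normfV (gtr0_norm Ph0) ler_pdivrMr//.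
apply: (@le_trans _ _ (h `^ (alpha + 1) / (alpha + 1) * `|f^`() c1| +
   h `^ (alpha + 1) / (alpha + 1) * `|f^`() c2| +
   h `^ (alpha + 1) / (alpha + 1) * `|f^`() c3| +
   h `^ (alpha + 1) / (alpha + 1) * `|f^`() c4|)).
  by do 3! apply: le_trans (ler_normD _ _) (lerD _ _) => //.
rewrite -!mulrDr PE le_eqVlt; apply/orP; left; apply/eqP.
by field; exact: lt0r_neq0.
Qed.
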